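(* Let $L\in\mathbb N$ and $0\le p<1$. Consider the Elephant Random Walk with finite disordered memory of length $L$ and acceptance probability $p$, defined as follows. A jar initially contains $N_0^+$ signs $+1$ and $N_0^-$ signs $-1$ with $N_0^++N_0^-=L$, and $X_0\in\mathbb Z$ is arbitrary. Inductively, at step $n+1$: a sign is drawn uniformly at random from the $L$ signs in the jar and removed (without replacement); independently, with probability $p$ it is kept and with probability $1-p$ it is multiplied by $-1$, giving the new sign $s_{n+1}\in\{\pm1\}$; set $X_{n+1}=X_n+s_{n+1}$; and put $s_{n+1}$ into the jar (so the jar again contains $L$ signs). Then $$\lim_{t\to\infty}\frac{X_t}{t}=0\ \text{ a.s.},\qquad \frac{X_t}{\sqrt t}\Rightarrow N\Big(0,\frac{p}{1-p}\Big).$$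
   Context: $N(0,\sigma^2)$ denotes the centered normal distribution with variance $\sigma^2$ (a point mass at $0$ when $\sigma^2=0$); $\Rightarrow$ denotes convergence in distribution. *)

(* Defs.v *)
From HB Require Import structures.
From mathcomp Require Import all_boot all_order all_algebra.
From mathcomp Require Import all_classical all_reals all_analysis.
Set Implicit Arguments. Unset Strict Implicit. Unset Printing Implicit Defensive.
Import Order.TTheory GRing.Theory Num.Theory.
Import numFieldNormedType.Exports.
Local Open Scope classical_set_scope.
Local Open Scope ring_scope.

Section erw.
Variable R : realType.

Definition sgn (b : bool) : R := if b then 1 else -1.

(* One step of the walk: the jar holds [k] plus-signs out of [L];
   [d] is the drawn sign, [s] the new sign (s = d: kept, s <> d: flipped).
   Probability of the pair (d, s) given the jar content k. *)
Definition step_prob (L : nat) (p : R) (k : nat) (ds : bool * bool) : R :=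
  (if ds.1 then k%:R / L%:R else (L - k)%:R / L%:R) *
  (if ds.2 == ds.1 then p else 1 - p).

Definition jar_next (k : nat) (ds : bool * bool) : nat :=
  (k - nat_of_bool ds.1 + nat_of_bool ds.2)%N.

Fixpoint path_prob (L : nat) (p : R) (k : nat) (h : seq (bool * bool)) : R :=
  match h with
  | [::] => 1
  | ds :: h' => step_prob L p k ds * path_prob L p (jar_next k ds) h'
  end.

(* position X_t = X_0 + s_1 + ... + s_t, where S i is s_{i+1} *)
Definition erw_pos (T : Type) (X0 : int) (S : nat -> T -> bool) (t : nat) (w : T) : R :=
  X0%:~R + \sum_(i < t) sgn (S i w).

Definition gauss_expect (v : R) (f : R -> R) : R :=
  if v == 0 then f 0
  else Rintegral lebesgue_measure setT
         (fun x => f x * normal_pdf 0 (Num.sqrt v) x).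

End erw.
Arguments erw_pos {R T}.

(* Main.v *)
(** Write v = p / (1 - p). Let xi_n = s_n if the drawn sign d_n is kept and
    xi_n = v * s_n if it is flipped. Given the past and d_n, xi_n has mean 0
    and variance v whatever the content of the jar, and
    s_n - xi_n = (1 - v) / 2 * (s_n - d_n), whose sum telescopes to a multiple of
    the change of the jar content. Hence X_t stays within a bounded distance of
    the martingale M_t = xi_1 + ... + xi_t with bounded increments and constant
    conditional variance.

    Law of large numbers: E[X_t^2] = O(t), so the series of (X_{n^2} / n^2)^2 has finite
    expectation, and the increments of X are bounded by 1.

    Central limit theorem: for a test function f with three bounded derivatives,
    Lindeberg's telescoping compares E[f(M_t / sqrt t)] with the Gaussian
    expectation; the Gaussian side of each step is Stein's identity
    E[N g(N)] = v E[g'(N)], valid also for the point mass v = 0. A bounded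
    continuous f is approximated, up to e * (1 + x^2), by averaging it three
    times over small windows; second moments then control the error. *)
Require Import Defs.
From HB Require Import structures.
From mathcomp Require Import all_boot all_order all_algebra.
From mathcomp Require Import all_classical all_reals all_analysis.
From mathcomp Require Import measurable_realfun ring lra.
Import Order.TTheory GRing.Theory Num.Theory.
Import numFieldNormedType.Exports.
Local Open Scope classical_set_scope.
Local Open Scope ring_scope.

Set Implicit Arguments.
Unset Strict Implicit.
Unset Printing Implicit Defensive.

(** * Smoothing and Taylor bounds *)

Section calculus.
Variable R : realType.
Implicit Types (f F : R -> R).
Notation mu := (@lebesgue_measure R).

(** The integral from a fixed base point is a primitive only to the right of that point. The base
    point therefore moves with [x], and subtracting the integral up to [0] makes the value
    independent of it. *)
Lemma continuous_has_primitive f : continuous f ->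
  exists F, forall x : R, is_derive x 1 F (f x).
Proof.
move=> cf.
have fi a b : mu.-integrable `[a, b] (EFin \o f).
  apply: continuous_compact_integrable; first exact: segment_compact.
  exact: continuous_subspaceT.
pose I a x := \int[mu]_(t in `[a, x]) f t.
have IB a b x : a <= b -> b <= x -> I a x - I a b = I b x.
  move=> ab bx; rewrite /I Rintegral_itvB//.
  by rewrite Rintegral_itv_obnd_cbnd//; apply: integrableS (fi b x) => //; exact: subset_itv_oc_cc.
pose F (x : R) := I (- `|x| - 1) x - I (- `|x| - 1) 0.
have FE (a x : R) : a <= - `|x| -1 -> F x = I a x - I a 0.
  move=> ax; have := normr_ge0 x; have := ler_norm (- x); rewrite normrN => x1 x2.
  rewrite /F -(IB a (- `|x| - 1) x) -?(IB a (- `|x| - 1) 0); lra.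
exists F => x.
(* One unit further left than in [F x], so that this single base point serves every [y] within
   distance 1 of [x]. *)
pose a : R := - `|x| - 2.
have [dI I'] : derivable (I a) x 1 /\ (derive1 (I a) x) = f x.
  apply: (@continuous_FTC1_closed R f a x (x + 1)) => //; first by rewrite ltrDl.
  - by rewrite /a; have := ler_norm (- x); rewrite normrN; lra.
  - exact: cf.
have dF : is_derive x 1 (fun y => I a y - I a 0) (f x).
  rewrite -[f x]subr0; apply: is_deriveB.
  by apply: DeriveDef => //; rewrite -derive1E I'.
apply: near_eq_is_derive dF.
near=> y; rewrite (FE a)//.
have : `|x - y| <= 1 by near: y; apply: cvgr_dist_le; [exact: cvg_id|exact: ltr01].
by have := ler_distD x y 0; rewrite !subr0 (distrC y x) /a; lra.
Unshelve. all: by end_near. Qed.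

Definition bounded_fct f := exists M, forall x, `|f x| <= M.

(** Derivatives are carried as witnesses, so that a window average can exhibit its own as a
    difference quotient. *)
Fixpoint smoothb (n : nat) f : Prop :=
  continuous f /\ bounded_fct f /\
  if n is n'.+1 then exists f', (forall x : R, is_derive x 1 f (f' x)) /\ smoothb n' f'
  else True.


Lemma is_derive_continuous f f' : (forall x : R, is_derive x 1 f (f' x)) -> continuous f.
Proof.
by move=> df x; apply/differentiable_continuous/derivable1_diffP; case: (df x).
Qed.

Lemma smoothb_cont n f : smoothb n f -> continuous f.
Proof. by case: n => [|n] []. Qed.

Lemma smoothb_bounded n f : smoothb n f -> bounded_fct f.
Proof. by case: n => [|n] [_ []]. Qed.

Lemma is_derive_comp_shift f f' (h : R) : (forall x : R, is_derive x 1 f (f' x)) ->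
  forall x : R, is_derive x 1 (fun y => f (y + h)) (f' (x + h)).
Proof.
move=> df x; rewrite -[X in is_derive _ _ _ X]mulr1.
exact: (@is_derive1_comp R f (shift h) x _ _ (df _) (is_derive_shift _ _ _)).
Qed.

(** Window averages have derivatives of this form, so averaging keeps the smoothness already
    present. *)
Lemma smoothb_diff_quotient n f (a b c : R) : smoothb n f ->
  smoothb n (fun x => c * (f (x + a) - f (x + b))).
Proof.
elim: n f => [|n IH] f.
  move=> [cf [[M fM] _]]; split=> [x|].
    have cs (a' : R) : {for x, continuous (fun y => f (y + a'))}.
      by apply: (continuous_comp (f := fun y => y + a')); [apply: cvgD; [exact: cvg_id|exact: cvg_cst]|exact: cf].
    by apply: cvgMr; apply: cvgB; exact: cs.
  split=> //; exists (`|c| * (M + M)) => x; rewrite normrM ler_wpM2l//.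
  by rewrite (le_trans (ler_normB _ _))// lerD.
move=> [cf [[M fM] [f' [df sf']]]]; have dq x : is_derive (x : R) 1 (fun x => c * (f (x + a) - f (x + b))) (c * (f' (x + a) - f' (x + b))).
  apply: is_deriveZ. apply: is_deriveB; exact: is_derive_comp_shift.
split; first exact: is_derive_continuous dq.
split.
  exists (`|c| * (M + M)) => x; rewrite normrM ler_wpM2l//.
  by rewrite (le_trans (ler_normB _ _))// lerD.
by exists (fun x => c * (f' (x + a) - f' (x + b))); split => //; exact: IH.
Qed.

(* Averaging over windows [x - h, x + h] gains one derivative; by the mean
   value theorem the average is a value taken by f in the window. *)
Lemma smoothb_average n f (h : R) : 0 < h -> smoothb n f ->
  exists g, smoothb n.+1 g /\ forall x, exists2 c, `|c - x| <= h & g x = f c.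
Proof.
move=> h0 sf; have [F dF] := continuous_has_primitive (smoothb_cont sf).
pose g x := (2 * h)^-1 * (F (x + h) - F (x + (- h))).
have gE x : exists2 c, `|c - x| <= h & g x = f c.
  have hh : x - h <= x + h by lra.
  have [c] := MVT_segment hh (fun y _ => dF y) (continuous_subspaceT (is_derive_continuous dF)).
  rewrite in_itv/= => /andP[xc cx] E; exists c.
    by rewrite ler_norml; apply/andP; split; lra.
  by rewrite /g E; field; rewrite gt_eqF.
have dg x : is_derive (x : R) 1 g ((2 * h)^-1 * (f (x + h) - f (x + (- h)))).
  by apply: is_deriveZ; apply: is_deriveB; exact: is_derive_comp_shift.
exists g; split=> //; split; first exact: is_derive_continuous dg.
split.
  by have [M fM] := smoothb_bounded sf; exists M => x; have [c _ ->] := gE x.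
by exists (fun x => (2 * h)^-1 * (f (x + h) - f (x + (- h)))); split => //; exact: smoothb_diff_quotient.
Qed.

(** [f] need not be uniformly continuous on the whole line. On a compact interval it is, and three
    averages move the point of evaluation by at most [3 * h]; outside, the weight [1 + x ^+ 2]
    absorbs the crude bound [2 * M]. *)
Lemma smoothb3_dense f (e : R) : continuous f -> bounded_fct f -> 0 < e ->
  exists2 g, smoothb 3 g & forall x, `|f x - g x| <= e * (1 + x ^+ 2).
Proof.
move=> cf [M fM] e0.
have M0 : 0 <= M by exact: le_trans (fM 0).
(* Chosen so that [2 * M <= e * K], with [1 <= K] so that $|x| \ge K$ implies $x^2 \ge K$. *)
pose K := 1 + 2 * M / e.
have K1 : 1 <= K by rewrite lerDl divr_ge0 ?mulr_ge0// ltW.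
have [h /andP[h0 h1] hu] : exists2 h, 0 < h <= 1 & forall x y, `|x| <= K -> `|y - x| <= 3 * h -> `|f x - f y| <= e.
  have /compact_near_coveringP NC := @segment_compact R (- K) K.
  have /= H := NC R (0%R^'+) (fun h x => forall y, `|y - x| <= 3 * h -> `|f x - f y| <= e) _ _.
  suff : \forall h \near 0%R^'+, (0 < h <= 1) /\ [set` `[- K, K]] `<=` (fun x => forall y, `|y - x| <= 3 * h -> `|f x - f y| <= e).
    move/filter_ex => [h [h01 hP]]; exists h => // x y xK; apply: hP.
    by rewrite /= in_itv/= -ler_norml.
  near=> h; split.
    by apply/andP; split; near: h; [exact: nbhs_right_gt|exact: nbhs_right_le].
  near: h; apply: H => x _.
  have /cvgrPdist_lt/(_ (e / 2)) := cf x; rewrite divr_gt0// => /(_ isT) /nbhs_ballP[d /= d0 dP].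
  (* [x'] is within [d / 2] of [x] and [3 * h < d / 2], so [x'] and [y] both lie in the ball of
     radius [d] around [x]. *)
  exists (ball x (d / 2), [set h | 0 < h < d / 6]) => /=.
    split; first by apply: nbhsx_ballx; rewrite divr_gt0.
    near=> h; apply/andP; split; near: h; [exact: nbhs_right_gt|].
    by apply: nbhs_right_lt; rewrite divr_gt0.
  move=> [x' h] /= [xx' /andP[h0 hd]] y yx'.
  move: xx'; rewrite -ball_normE /= => xx'.
  have fx' : `|f x - f x'| < e / 2 by apply: dP; rewrite -ball_normE/=; lra.
  have fy : `|f x - f y| < e / 2.
    by apply: dP; rewrite -ball_normE/=; have := ler_distD x' x y; rewrite (distrC x' y); lra.
  by have := ler_distD (f x) (f x') (f y); rewrite (distrC (f x') (f x)); lra.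
have [g1 [s1 E1]] := @smoothb_average 0 f h h0 (conj cf (conj (ex_intro _ M fM) I)).
have [g2 [s2 E2]] := smoothb_average h0 s1.
have [g3 [s3 E3]] := smoothb_average h0 s2.
exists g3 => // x.
have [c3 d3 ->] := E3 x; have [c2 d2 ->] := E2 c3; have [c d1 ->] := E1 c2.
have cx : `|c - x| <= 3 * h.
  have := ler_distD c2 c x; have := ler_distD c3 c2 x; lra.
have x2 := sqr_ge0 x.
have [xK|Kx] := leP `|x| K.
  by apply: (le_trans (hu _ _ xK cx)); rewrite ler_peMr ?lerDl// ltW.
have : `|f x - f c| <= 2 * M.
  by rewrite (le_trans (ler_normB _ _))// mulr_natl lerD.
move/le_trans; apply.
have eK : 2 * M <= e * K by rewrite /K mulrDr mulrCA divff ?gt_eqF// mulr1 mulr1 lerDr ltW.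
apply: (le_trans eK); rewrite ler_pM2l//.
rewrite -(real_normK (num_real x)).
have : `|x| <= `|x| ^+ 2 by rewrite expr2 ler_peMr// (le_trans K1)// ltW.
lra.
Unshelve. all: by end_near. Qed.

(** * Taylor remainders from the mean value theorem *)

Lemma mvt_bound f f' (B x h : R) : (forall x : R, is_derive x 1 f (f' x)) ->
  (forall y, `|y - x| <= `|h| -> `|f' y| <= B) -> `|f (x + h) - f x| <= B * `|h|.
Proof.
move=> df fB; have cf := is_derive_continuous df.
have [h0|/ltW h0] := leP 0 h.
  have hh : x <= x + h by lra.
  have [c] := MVT_segment hh (fun y _ => df y) (continuous_subspaceT cf).
  rewrite in_itv/= => /andP[xc cx] ->; rewrite normrM (addrC x) addrK ler_wpM2r//.
  by apply: fB; rewrite (ger0_norm h0) ger0_norm; lra.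
have hh : x + h <= x by lra.
have [c] := MVT_segment hh (fun y _ => df y) (continuous_subspaceT cf).
rewrite in_itv/= distrC => /andP[xc cx] ->; rewrite normrM opprD addNKr normrN ler_wpM2r//.
by apply: fB; rewrite (ler0_norm h0) ler0_norm; lra.
Qed.

(** The remainder vanishes at increment 0 and its derivative is a difference of [f1], at most
    $C|h|$. Two uses of [mvt_bound] give the constant [C] in place of [C / 2]. *)
Lemma taylor1 f f1 f2 (C x h : R) : (forall x : R, is_derive x 1 f (f1 x)) ->
  (forall x : R, is_derive x 1 f1 (f2 x)) -> (forall x, `|f2 x| <= C) ->
  `|f (x + h) - f x - h * f1 x| <= C * h ^+ 2.
Proof.
move=> df df1 f2C; have C0 : 0 <= C by exact: le_trans (f2C 0).
pose r y := f (x + y) - f x - y * f1 x.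
have dr (y : R) : is_derive y 1 r (f1 (x + y) - f1 x).
  have d := is_derive_comp_shift x df y; rewrite (addrC y) in d.
  have -> : r = (fun y => f (y + x)) - cst (f x) - (f1 x \*: id).
    by apply/funext => z; rewrite /r !fctE/= (addrC x) (mulrC z).
  apply: is_derive_eq. rewrite subr0 [_ *: _]mulr1 //.
have := @mvt_bound r (fun y => f1 (x + y) - f1 x) (C * `|h|) 0 h dr.
rewrite /r addr0 add0r subrr mul0r !subr0 -mulrA -expr2 real_normK ?num_real//.
apply=> y; rewrite subr0 => yh.
by apply: le_trans (ler_wpM2l C0 yh); apply: mvt_bound df1 _.
Qed.

(** One order higher: the derivative of the remainder is the first-order remainder of [f1], which
    [taylor1] bounds. *)
Lemma taylor2 f f1 f2 f3 (C x h : R) : (forall x : R, is_derive x 1 f (f1 x)) ->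
  (forall x : R, is_derive x 1 f1 (f2 x)) -> (forall x : R, is_derive x 1 f2 (f3 x)) ->
  (forall x, `|f3 x| <= C) ->
  `|f (x + h) - f x - h * f1 x - h ^+ 2 / 2 * f2 x| <= C * `|h| ^+ 3.
Proof.
move=> df df1 df2 f3C; have C0 : 0 <= C by exact: le_trans (f3C 0).
pose r y := f (x + y) - f x - y * f1 x - y ^+ 2 / 2 * f2 x.
have dr (y : R) : is_derive y 1 r (f1 (x + y) - f1 x - y * f2 x).
  have d := is_derive_comp_shift x df y; rewrite (addrC y) in d.
  have -> : r = (fun y => f (y + x)) - cst (f x) - (f1 x \*: id) - ((f2 x / 2) \*: (id ^+ 2)).
    by apply/funext => z; rewrite /r !fctE/= (addrC x) (mulrC z) (mulrAC _ _ (f2 x)) (mulrC _ (f2 x)) mulrAC.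
  apply: is_derive_eq; rewrite subr0 /= expr1 /GRing.scale/= !mulr1.
  by field.
have E : C * `|h| ^+ 3 = C * `|h| ^+ 2 * `|h| by rewrite -mulrA -exprSr.
have := @mvt_bound r _ (C * `|h| ^+ 2) 0 h dr.
rewrite E /r addr0 add0r subrr expr0n/= !mul0r !subr0.
apply=> y; rewrite subr0 => yh.
apply: (le_trans (taylor1 x y df1 df2 f3C)); rewrite ler_wpM2l//.
by rewrite -(real_normK (num_real y)) lerXn2r ?nnegrE.
Qed.


Lemma growth2_bound f (M : R) : (forall x, `|f x| <= M) -> forall x, `|f x| <= M * (1 + x ^+ 2).
Proof.
move=> fM x; apply: (le_trans (fM x)).
by rewrite ler_peMr ?(le_trans _ (fM x))// lerDl sqr_ge0.
Qed.

End calculus.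

(** * Gaussian expectations *)

Section gauss.
Variable R : realType.
Implicit Types (f g : R -> R) (v s : R).
Notation mu := (@lebesgue_measure R).

(** A class of Gaussian-integrable functions, wide enough for [x ^+ 2] and for the unbounded side
    [x * g x] of Stein's identity. *)
Definition growth2 f := continuous f /\ exists C, forall x, `|f x| <= C * (1 + x ^+ 2).

Lemma growth2_bounded f : continuous f -> bounded_fct f -> growth2 f.
Proof. by move=> cf [M fM]; split=> //; exists M; exact: growth2_bound. Qed.

Lemma growth2D f g : growth2 f -> growth2 g -> growth2 (fun x => f x + g x).
Proof.
move=> [cf [C fC]] [cg [D gD]]; split; first by move=> x; apply: cvgD; [exact: cf|exact: cg].
by exists (C + D) => x; rewrite mulrDl (le_trans (ler_normD _ _))// lerD.
Qed.

Lemma growth2Z f (k : R) : growth2 f -> growth2 (fun x => k * f x).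
Proof.
move=> [cf [C fC]]; split; first by move=> x; apply: cvgMr; exact: cf.
by exists (`|k| * C) => x; rewrite normrM -mulrA ler_wpM2l.
Qed.

Lemma growth2_cst (k : R) : growth2 (fun=> k).
Proof. by apply: growth2_bounded; [move=> x; exact: cvg_cst|exists `|k|]. Qed.

Lemma growth2_sqr : growth2 (fun x => x ^+ 2).
Proof.
split; first exact: exprn_continuous.
by exists 1 => x; rewrite mul1r ger0_norm ?sqr_ge0// lerDr.
Qed.

Lemma growth2_idM g : continuous g -> bounded_fct g -> growth2 (fun x => x * g x).
Proof.
move=> cg [M gM]; split; first by move=> x; apply: cvgM; [exact: cvg_id|exact: cg].
exists M => x; rewrite normrM mulrC.
have M0 : 0 <= M by exact: le_trans (gM 0).
apply: ler_pM => //; rewrite -(real_normK (num_real x)).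
have := sqr_ge0 (`|x| - 1); rewrite sqrrB1; have := normr_ge0 x.
by have := sqr_ge0 `|x|; lra.
Qed.

(** Domination by a wider Gaussian: with $y = x^2/(4s^2)$ the exponential is $e^{-y}e^{-y}$. One
    factor absorbs the polynomial since $ye^{-y} \le 1$; the other is, up to the peaks whose ratio
    enters [c], the density with standard deviation $\sqrt2\,s$. *)
Lemma integrable_sqr_normal_pdf s : 0 < s ->
  mu.-integrable setT (EFin \o (fun x => (1 + x ^+ 2) * normal_pdf 0 s x)).
Proof.
move=> s0.
have s20 : 0 < Num.sqrt 2 * s by rewrite mulr_gt0// sqrtr_gt0.
pose c := (1 + 4 * s ^+ 2) * normal_peak s / normal_peak (Num.sqrt 2 * s).
have : mu.-integrable setT (EFin \o (fun x => c * normal_pdf 0 (Num.sqrt 2 * s) x)).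
  apply: (@eq_integrable _ _ _ mu setT _ (fun x => c%:E * (normal_pdf 0 (Num.sqrt 2 * s) x)%:E)%E) => //.
  by apply: integrableZl => //; exact: integrable_normal_pdf.
apply: le_integrable => //.
  apply/measurable_EFinP/measurable_funM; last exact: measurable_normal_pdf.
  by apply: measurable_funD => //; exact: exprn_measurable.
move=> x _ /=; rewrite lee_fin [leLHS]normrM.
have c0 : 0 <= c.
  by rewrite divr_ge0 ?mulr_ge0 ?normal_peak_ge0// addr_ge0// mulr_ge0// sqr_ge0.
have x0 : 0 <= 1 + x ^+ 2 by rewrite addr_ge0// sqr_ge0.
rewrite (ger0_norm x0) [leRHS]ger0_norm; last by rewrite mulr_ge0// normal_pdf_ge0.
rewrite ger0_norm ?normal_pdf_ge0// /c.
rewrite !normal_pdfE ?gt_eqF// mulrCA.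
have B0 : normal_peak (Num.sqrt 2 * s) != 0 by rewrite gt_eqF// normal_peak_gt0// gt_eqF.
have -> : forall A E : R, (1 + 4 * s ^+ 2) * A / normal_peak (Num.sqrt 2 * s) *
    (normal_peak (Num.sqrt 2 * s) * E) = A * ((1 + 4 * s ^+ 2) * E).
  by move=> A E; field.
rewrite ler_wpM2l ?normal_peak_ge0//.
rewrite /normal_fun !subr0 exprMn sqr_sqrtr//.
pose y := x ^+ 2 / (4 * s ^+ 2).
have s2 : 0 < s ^+ 2 by rewrite exprn_gt0.
have y0 : 0 <= y by rewrite divr_ge0 ?sqr_ge0// mulr_ge0// ltW.
have -> : - x ^+ 2 / (s ^+ 2 *+ 2) = - y + - y by rewrite /y; field; rewrite gt_eqF.
have -> : - x ^+ 2 / (2 * s ^+ 2 *+ 2) = - y by rewrite /y; field; rewrite gt_eqF.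
rewrite expRD mulrA ler_wpM2r ?expR_ge0//.
have -> : x ^+ 2 = 4 * s ^+ 2 * y by rewrite /y mulrCA divff ?mulr1// gt_eqF// mulr_gt0.
have e1 : expR (- y) <= 1 by rewrite -expR0 ler_expR oppr_le0.
have ye : y * expR (- y) <= 1.
  rewrite expRN ler_pdivrMr ?expR_gt0// mul1r (le_trans _ (expR_ge1Dx y))// lerDr//.
by rewrite mulrDl mul1r lerD// -(mulrA (4 * _)) ler_piMr// mulr_ge0// ltW.
Qed.

Lemma integrable_normal_pdf_growth2 s f : 0 < s -> growth2 f ->
  mu.-integrable setT (EFin \o (fun x => f x * normal_pdf 0 s x)).
Proof.
move=> s0 [cf [C fC]].
have C0 : 0 <= C by have := fC 0; rewrite expr0n addr0 mulr1; exact: le_trans.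
have : mu.-integrable setT (EFin \o (fun x => C * ((1 + x ^+ 2) * normal_pdf 0 s x))).
  apply: (@eq_integrable _ _ _ mu setT _ (fun x => C%:E * ((1 + x ^+ 2) * normal_pdf 0 s x)%:E)%E) => //.
  by apply: integrableZl => //; exact: integrable_sqr_normal_pdf.
apply: le_integrable => //.
  apply/measurable_EFinP/measurable_funM; last exact: measurable_normal_pdf.
  exact: continuous_measurable_fun.
move=> x _ /=; rewrite lee_fin !normrM (ger0_norm (normal_pdf_ge0 _ _ _)) mulrA ler_wpM2r ?normal_pdf_ge0//.
by rewrite (ger0_norm C0) (le_trans (fC x))// ler_wpM2l// ler_norm.
Qed.


Let normal_expect s f := \int[mu]_x (f x * normal_pdf 0 s x).

Lemma normal_expectD s f g : 0 < s -> growth2 f -> growth2 g ->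
  normal_expect s (fun x => f x + g x) = normal_expect s f + normal_expect s g.
Proof.
move=> s0 gf gg; rewrite /normal_expect; under eq_Rintegral do rewrite mulrDl.
by rewrite RintegralD//; exact: integrable_normal_pdf_growth2.
Qed.

Lemma normal_expectZ s f (k : R) : 0 < s -> growth2 f ->
  normal_expect s (fun x => k * f x) = k * normal_expect s f.
Proof.
move=> s0 gf; rewrite /normal_expect; under eq_Rintegral do rewrite -mulrA.
by rewrite RintegralZl//; exact: integrable_normal_pdf_growth2.
Qed.

Lemma normal_expect_le s f g : 0 < s -> growth2 f -> growth2 g ->
  (forall x, f x <= g x) -> normal_expect s f <= normal_expect s g.
Proof.
move=> s0 gf gg fg; apply: le_Rintegral => //; try exact: integrable_normal_pdf_growth2.
by move=> x _; rewrite ler_wpM2r ?normal_pdf_ge0.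
Qed.

Lemma normal_expect_cst s (k : R) : 0 < s -> normal_expect s (fun=> k) = k.
Proof.
move=> s0; rewrite /normal_expect RintegralZl//; last exact: integrable_normal_pdf.
by rewrite /Rintegral integral_normal_pdf mulr1.
Qed.

Lemma is_derive_normal_pdf s (x : R) : 0 < s ->
  is_derive x 1 (normal_pdf 0 s) (- (x / s ^+ 2 * normal_pdf 0 s x)).
Proof.
move=> s0; rewrite normal_pdfE ?gt_eqF//.
have -> : (fun x => normal_peak s * normal_fun 0 s x) =
   normal_peak s \*: (expR \o ((- (s ^+ 2 *+ 2)^-1) \*: (id ^+ 2))).
  apply/funext => z; rewrite !fctE /normal_fun subr0; congr (_ * expR _).
  by rewrite -[RHS]/(- (s ^+ 2 *+ 2)^-1 * z ^+ 2) !mulNr mulrC.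
apply: is_derive_eq; rewrite /GRing.scale/= !fctE /normal_fun subr0.
rewrite (_ : - (s ^+ 2 *+ 2)^-1 *: x ^+ 2 = - x ^+ 2 / (s ^+ 2 *+ 2)); first by field; rewrite gt_eqF.
by rewrite -[LHS]/(- (s ^+ 2 *+ 2)^-1 * x ^+ 2) !mulNr mulrC.
Qed.

(* Integrating (g * pdf)' over [-n, n] and letting n go to infinity: the
   boundary terms vanish since g is bounded and pdf tends to 0. *)
Lemma normal_expect_stein s g g' : 0 < s -> (forall x : R, is_derive x 1 g (g' x)) ->
  continuous g' -> bounded_fct g -> bounded_fct g' ->
  normal_expect s (fun x => x * g x) = s ^+ 2 * normal_expect s g'.
Proof.
move=> s0 dg cg' bg bg'; have cg := is_derive_continuous dg.
pose h x := (g' x + - (s ^+ 2)^-1 * (x * g x)) * normal_pdf 0 s x.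
have gh : growth2 (fun x => g' x + - (s ^+ 2)^-1 * (x * g x)).
  by apply: growth2D; [exact: growth2_bounded|apply: growth2Z; exact: growth2_idM].
have ih := integrable_normal_pdf_growth2 s0 gh.
have ch : continuous h.
  by case: gh => ch _ x; apply: cvgM; [exact: ch|apply: continuous_normal_pdf; rewrite gt_eqF].
suff h0 : \int[mu]_x h x = 0.
  have := h0; rewrite /h -/(normal_expect s (fun x => g' x + - (s ^+ 2)^-1 * (x * g x))).
  rewrite normal_expectD//; [|exact: growth2_bounded|by apply: growth2Z; exact: growth2_idM].
  rewrite normal_expectZ//; last exact: growth2_idM.
  move/eqP; rewrite mulNr subr_eq0 => /eqP ->.
  by rewrite mulrA divff ?mul1r// gt_eqF// exprn_gt0.
pose G x := g x * normal_pdf 0 s x.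
have dG (x : R) : is_derive x 1 G (h x).
  have dn := is_derive_normal_pdf x s0.
  have -> : G = g * normal_pdf 0 s by [].
  apply: is_derive_eq; rewrite /h /GRing.scale/=; field.
  by rewrite gt_eqF.
have FTC (a : R) : 0 < a -> (\int[mu]_(x in `[(- a)%R, a]) (h x)%:E = (G a)%:E - (G (- a)%R)%:E)%E.
  move=> a0; have cG := is_derive_continuous dG.
  apply: continuous_FTC2.
  - by rewrite gtrN.
  - exact: continuous_subspaceT.
  - split; first by move=> x _; case: (dG x).
    + exact/cvg_at_right_filter/cG.
    + exact/cvg_at_left_filter/cG.
  - by move=> x _; rewrite derive1E derive_val.
have [M gM] := bg.
have M0 : 0 <= M by exact: le_trans (gM 0).
(* From [u <= expR u] at $u = a^2/(2s^2)$; decay of order $1/|a|$ suffices for the boundary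
   terms. *)
have Gb (a : R) : 1 <= `|a| -> `|G a| <= M * normal_peak s * (2 * s ^+ 2) * `|a|^-1.
  move=> a1; rewrite /G normrM (ger0_norm (normal_pdf_ge0 _ _ _)) -!mulrA.
  apply: ler_pM => //; first exact: normal_pdf_ge0.
  rewrite normal_pdfE ?gt_eqF// ler_wpM2l ?normal_peak_ge0// /normal_fun subr0.
  have a0 : 0 < `|a| by exact: lt_le_trans a1.
  rewrite mulNr expRN -[leLHS]mul1r ler_pdivrMr ?expR_gt0//.
  have ye : a ^+ 2 / (s ^+ 2 *+ 2) <= expR (a ^+ 2 / (s ^+ 2 *+ 2)).
    by rewrite (le_trans _ (expR_ge1Dx _))// lerDr.
  have c0 : 0 <= 2 * s ^+ 2 * `|a|^-1.
    by rewrite divr_ge0 ?normr_ge0// mulr_ge0// sqr_ge0.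
  rewrite !mulrA in c0 *; apply: le_trans (ler_wpM2l c0 ye).
  by rewrite -(real_normK (num_real a)) (_ : _ * _ = `|a|)//; field; rewrite !gt_eqF.
(* The truncated integrals have two limits: the full integral by dominated convergence, and 0 by
   [FTC] and [Gb]. Endpoints [n.+1] satisfy the hypotheses of both. *)
pose w (n : nat) (x : R) : R := h x * \1_([set` `[- n.+1%:R, n.+1%:R]] : set R) x.
have C1 : (\int[mu]_x (w n x)%:E)%E @[n --> \oo] --> (\int[mu]_x (h x)%:E)%E.
  apply: (@dominated_cvg _ _ _ mu setT _ _ _ (fun x => (`|h x|)%:E)) => //.
  - move=> n; apply/measurable_EFinP/measurable_funM; first exact: continuous_measurable_fun.
    exact: measurable_indic.
  - move=> x _; apply: cvg_near_cst.
    near=> n; rewrite /w indicE mem_set ?mulr1//= in_itv/= -ler_norml.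
    near: n; apply: filterS (nbhs_infty_ger `|x|) => n /le_trans; apply.
    by rewrite ler_nat.
  - exact: integrable_abse ih.
  - move=> n x _; rewrite lee_fin /w normrM ler_piMr// ger0_norm ?indicE//.
    by case: (_ \in _).
have C2 : (\int[mu]_x (w n x)%:E)%E @[n --> \oo] --> 0%E.
  have -> : (fun n => \int[mu]_x (w n x)%:E)%E =
     (fun n => (G n.+1%:R - G (- n.+1%:R))%:E).
    apply/funext => n; rewrite EFinB -FTC// [RHS]integral_mkcond.
    by apply: eq_integral => x _; rewrite patchE /w indicE; case: ifP; rewrite ?mulr1 ?mulr0.
  apply: cvg_EFin; first exact: nearW.
  rewrite /comp/=.
  have K0 : (fun n => 2 * (M * normal_peak s * (2 * s ^+ 2)) * harmonic n) @ \oo --> 0.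
    by rewrite -[X in _ --> X](mulr0 (2 * (M * normal_peak s * (2 * s ^+ 2)))); apply: cvgMr; exact: cvg_harmonic.
  apply/norm_cvg0P; apply: (squeeze_cvgr _ (cvg_cst 0) K0).
  near=> n; rewrite normr_ge0 /comp/= (le_trans (ler_normB _ _))//.
  have n1 : 1 <= `|n.+1%:R : R| by rewrite ger0_norm// ler1n.
  have := Gb _ n1; have := Gb (- n.+1%:R); rewrite normrN => /(_ n1).
  by rewrite /harmonic (ger0_norm (ler0n R n.+1)) => H1 H2; apply: (le_trans (lerD H2 H1)); rewrite -!mulrA [leRHS]mulr_natl mulr2n.
by rewrite /Rintegral (cvg_unique _ C1 C2).
Unshelve. all: by end_near. Qed.

(** * Expectation under $N(0,v)$, point mass included *)

Lemma gauss_expect_normal v f : 0 < v -> gauss_expect v f = normal_expect (Num.sqrt v) f.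
Proof. by move=> v0; rewrite /gauss_expect gt_eqF. Qed.

Lemma gauss_expectD v f g : 0 <= v -> growth2 f -> growth2 g ->
  gauss_expect v (fun x => f x + g x) = gauss_expect v f + gauss_expect v g.
Proof.
rewrite le_eqVlt => /predU1P[<-|v0]; first by rewrite /gauss_expect eqxx.
by rewrite !gauss_expect_normal//; apply: normal_expectD; rewrite sqrtr_gt0.
Qed.

Lemma gauss_expectZ v f (k : R) : 0 <= v -> growth2 f ->
  gauss_expect v (fun x => k * f x) = k * gauss_expect v f.
Proof.
rewrite le_eqVlt => /predU1P[<-|v0]; first by rewrite /gauss_expect eqxx.
by rewrite !gauss_expect_normal//; apply: normal_expectZ; rewrite sqrtr_gt0.
Qed.

Lemma gauss_expect_le v f g : 0 <= v -> growth2 f -> growth2 g ->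
  (forall x, f x <= g x) -> gauss_expect v f <= gauss_expect v g.
Proof.
rewrite le_eqVlt => /predU1P[<-|v0]; first by rewrite /gauss_expect eqxx => _ _; apply.
by rewrite !gauss_expect_normal//; apply: normal_expect_le; rewrite sqrtr_gt0.
Qed.

Lemma gauss_expect_cst v (k : R) : 0 <= v -> gauss_expect v (fun=> k) = k.
Proof.
rewrite le_eqVlt => /predU1P[<-|v0]; first by rewrite /gauss_expect eqxx.
by rewrite gauss_expect_normal// normal_expect_cst// sqrtr_gt0.
Qed.

Lemma gauss_expect_stein v g g' : 0 <= v -> (forall x : R, is_derive x 1 g (g' x)) ->
  continuous g' -> bounded_fct g -> bounded_fct g' ->
  gauss_expect v (fun x => x * g x) = v * gauss_expect v g'.
Proof.
rewrite le_eqVlt => /predU1P[<-|v0]; first by rewrite /gauss_expect eqxx !mul0r.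
move=> dg cg' bg bg'; have s0 : 0 < Num.sqrt v by rewrite sqrtr_gt0.
have := normal_expect_stein s0 dg cg' bg bg'.
by rewrite (sqr_sqrtr (ltW v0)) !gauss_expect_normal.
Qed.

Lemma gauss_expect_norm_le v f g : 0 <= v -> growth2 f -> growth2 g ->
  (forall x, `|f x| <= g x) -> `|gauss_expect v f| <= gauss_expect v g.
Proof.
move=> v0 gf gg fg; rewrite ler_norml -mulN1r -gauss_expectZ//.
apply/andP; split; apply: gauss_expect_le => //; first exact: growth2Z.
- by move=> x; rewrite mulN1r; have := fg x; rewrite ler_norml => /andP[].
- by move=> x; have := fg x; rewrite ler_norml => /andP[].
Qed.

End gauss.

(** * Gaussian averages and the path law *)

Section gauss_smoothing.
Variables (R : realType) (v : R).
Hypothesis v0 : 0 <= v.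
Implicit Types (f : R -> R) (a b h x : R).
Notation G := (gauss_expect v).

Lemma continuous_affine f a x : continuous f -> continuous (fun z => f (x + a * z)).
Proof.
move=> cf z; apply: (continuous_comp (f := fun z => x + a * z)); last exact: cf.
by apply: cvgD; [exact: cvg_cst|apply: cvgMr; exact: cvg_id].
Qed.

Lemma bounded_affine f a x : bounded_fct f -> bounded_fct (fun z => f (x + a * z)).
Proof. by move=> [M fM]; exists M => z. Qed.

Lemma growth2_affine f a x : continuous f -> bounded_fct f -> growth2 (fun z => f (x + a * z)).
Proof. by move=> cf bf; apply: growth2_bounded; [exact: continuous_affine|exact: bounded_affine]. Qed.

Lemma gauss_expect_comb3 (f0 f1 f2 f3 : R -> R) (c1 c2 c3 : R) :
  growth2 f0 -> growth2 f1 -> growth2 f2 -> growth2 f3 ->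
  growth2 (fun z => f0 z + c1 * f1 z + c2 * f2 z + c3 * f3 z) /\
  G (fun z => f0 z + c1 * f1 z + c2 * f2 z + c3 * f3 z) = G f0 + c1 * G f1 + c2 * G f2 + c3 * G f3.
Proof.
move=> g0 g1 g2 g3.
have h1 := growth2Z c1 g1; have h2 := growth2Z c2 g2; have h3 := growth2Z c3 g3.
have h01 := growth2D g0 h1; have h012 := growth2D h01 h2.
split; first exact: growth2D.
by rewrite !gauss_expectD// !gauss_expectZ.
Qed.

(** The heat flow, parametrized by the scale [a] instead of the time [a ^+ 2]; scale 0 gives back
    [f]. *)
Definition gauss_smooth f a x := G (fun z => f (x + a * z)).

Lemma gauss_smooth0 f x : gauss_smooth f 0 x = f x.
Proof. by rewrite /gauss_smooth; under eq_fun do rewrite mul0r addr0; rewrite gauss_expect_cst. Qed.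

Lemma gauss_smooth_bound f (C a x : R) : continuous f -> (forall x, `|f x| <= C) ->
  `|gauss_smooth f a x| <= C.
Proof.
move=> cf fC; rewrite -[leRHS](gauss_expect_cst C v0).
by apply: gauss_expect_norm_le => //; [apply: growth2_affine => //; exists C|exact: growth2_cst].
Qed.

Variables (f f1 f2 : R -> R) (C : R).
Hypothesis df : forall x : R, is_derive x 1 f (f1 x).
Hypothesis df1 : forall x : R, is_derive x 1 f1 (f2 x).
Hypothesis cf2 : continuous f2.
Hypothesis fC : forall x, `|f x| <= C.
Hypothesis f1C : forall x, `|f1 x| <= C.
Hypothesis f2C : forall x, `|f2 x| <= C.
Hypothesis taylor3 : forall x h, `|f (x + h) - f x - h * f1 x - h ^+ 2 / 2 * f2 x| <= C * `|h| ^+ 3.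

Let cf := is_derive_continuous df.
Let cf1 := is_derive_continuous df1.
Let bf : bounded_fct f. Proof. by exists C. Qed.
Let bf1 : bounded_fct f1. Proof. by exists C. Qed.
Let bf2 : bounded_fct f2. Proof. by exists C. Qed.

(** The Taylor bound [taylor3] holds at each point [x + a * z] with a constant independent of [z],
    so it survives averaging over [z]. *)
Lemma gauss_smooth_space a x h :
  `|gauss_smooth f a (x + h) - (gauss_smooth f a x + h * gauss_smooth f1 a x + h ^+ 2 / 2 * gauss_smooth f2 a x)|
  <= C * `|h| ^+ 3.
Proof.
have g y := growth2_affine a y cf bf.
have g1 := growth2_affine a x cf1 bf1; have g2 := growth2_affine a x cf2 bf2.
have [gg E] := gauss_expect_comb3 (-1) (- h) (- (h ^+ 2 / 2)) (g (x + h)) (g x) g1 g2.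
rewrite [X in `|X|](_ : _ = gauss_smooth f a (x + h) + -1 * gauss_smooth f a x
  + - h * gauss_smooth f1 a x + - (h ^+ 2 / 2) * gauss_smooth f2 a x); last by ring.
rewrite -E -[leRHS](gauss_expect_cst _ v0).
apply: gauss_expect_norm_le => //; first exact: growth2_cst.
move=> z; rewrite (_ : _ + _ = f ((x + a * z) + h) - f (x + a * z) - h * f1 (x + a * z) - h ^+ 2 / 2 * f2 (x + a * z))//.
by rewrite (addrAC x h); ring.
Qed.

Lemma is_derive_affine (k k' : R -> R) a x : (forall x : R, is_derive x 1 k (k' x)) ->
  forall z : R, is_derive z 1 (fun z => k (x + a * z)) (a * k' (x + a * z)).
Proof.
move=> dk z; rewrite (mulrC a).
have da : is_derive z 1 (fun z => x + a * z) a.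
  have -> : (fun z => x + a * z) = cst x + (a \*: id) by [].
  by apply: is_derive_eq; rewrite add0r [_ *: _]mulr1.
exact: (@is_derive1_comp R k (fun z => x + a * z) z _ _ (dk _) da).
Qed.

(* Stein's identity turns the first-order term in b - a into
   (b - a) a v f2, the discrete form of the heat equation. *)
Lemma gauss_smooth_time a b x :
  `|gauss_smooth f b x - (gauss_smooth f a x + (b - a) * (v * (a * gauss_smooth f2 a x)))|
  <= C * (b - a) ^+ 2 * G (fun z => z ^+ 2).
Proof.
have C0 : 0 <= C by exact: le_trans (fC 0).
have c1 := continuous_affine (a := a) (x := x) cf1; have b1 := bounded_affine a x bf1.
have g2 := growth2_affine a x cf2 bf2.
have S : G (fun z => z * f1 (x + a * z)) = v * (a * gauss_smooth f2 a x).
  rewrite (gauss_expect_stein v0 (is_derive_affine a x df1))//; first by rewrite gauss_expectZ.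
  - by case: (growth2Z a g2).
  - by exists (`|a| * C) => z; rewrite normrM ler_wpM2l.
have [gg E] := gauss_expect_comb3 (-1) (- (b - a)) 0 (growth2_affine b x cf bf)
   (growth2_affine a x cf bf) (growth2_idM c1 b1) (growth2_cst 0).
rewrite [X in `|X|](_ : _ = gauss_smooth f b x + -1 * gauss_smooth f a x
  + - (b - a) * G (fun z => z * f1 (x + a * z)) + 0 * G (fun=> 0)); last by rewrite S; ring.
rewrite -E -gauss_expectZ//; last exact: growth2_sqr.
apply: gauss_expect_norm_le => //; first exact/growth2Z/growth2_sqr.
move=> z; rewrite -[leRHS]mulrA -exprMn.
rewrite [X in `|X|](_ : _ = f (x + a * z + (b - a) * z) - f (x + a * z) - (b - a) * z * f1 (x + a * z)).
  exact: taylor1 df df1 f2C.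
by have -> : x + a * z + (b - a) * z = x + b * z; ring.
Qed.

End gauss_smoothing.


(** * The path law and the martingale part of the walk *)

Section walk.
Variables (R : realType) (L : nat) (p : R).
Hypotheses (L0 : (0 < L)%N) (p0 : 0 <= p) (p1 : p < 1).
Implicit Types (h : seq (bool * bool)) (F : seq (bool * bool) -> R).
Let v := p / (1 - p).

Let v_ge0 : 0 <= v. Proof. by rewrite divr_ge0// subr_ge0 ltW. Qed.

Definition path_expect k t F : R :=
  \sum_(h : t.-tuple (bool * bool)) path_prob L p k h * F h.

(* The martingale increment: conditionally on the drawn sign it has mean 0 and
   variance p / (1 - p). *)
Definition noise (ds : bool * bool) : R := sgn R ds.2 * (if ds.2 == ds.1 then 1 else v).

Definition noise_sum h : R := \sum_(ds <- h) noise ds.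
Definition sign_sum h : R := \sum_(ds <- h) sgn R ds.2.

Lemma step_prob_ge0 k ds : 0 <= step_prob L p k ds.
Proof.
rewrite /step_prob mulr_ge0//; first by case: ifP => _; rewrite divr_ge0.
by case: ifP => // _; rewrite subr_ge0 ltW.
Qed.

Lemma path_prob_ge0 k h : 0 <= path_prob L p k h.
Proof. by elim: h k => //= ds h IH k; rewrite mulr_ge0 ?step_prob_ge0. Qed.

(** Mass 1, mean 0 and second moment [v] in one identity. For either drawn sign $d$ the mean is $pd
    - (1-p)vd = 0$ and the second moment $p + (1-p)v^2 = v$, so the jar content enters only through
    $k/L + (L-k)/L = 1$. *)
Lemma step_noise k (a b c : R) : (k <= L)%N ->
  \sum_ds step_prob L p k ds * (a + noise ds * b + noise ds ^+ 2 * c) = a + v * c.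
Proof.
move=> kL; rewrite -(pair_bigA _ (fun d s => step_prob L p k (d, s) * (a + noise (d, s) * b + noise (d, s) ^+ 2 * c)))/=.
rewrite !big_bool /step_prob /noise /sgn/= natrB// /v.
by field; rewrite pnatr_eq0 -lt0n L0 gt_eqF// subr_gt0.
Qed.

Lemma step_prob_sum1 k : (k <= L)%N -> \sum_ds step_prob L p k ds = 1.
Proof.
move=> kL; have := step_noise 1 0 0 kL; rewrite mulr0 addr0 => <-.
by apply: eq_bigr => ds _; rewrite !mulr0 !addr0 mulr1.
Qed.

(** A plus sign has positive probability only if [0 < k], a minus sign only if [k < L]; so the
    truncated subtraction in [jar_next] is a true one and the jar never exceeds [L] plus signs. *)
Lemma step_prob_support k ds : (k <= L)%N -> step_prob L p k ds != 0 ->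
  (jar_next k ds <= L)%N /\
  2 * (jar_next k ds)%:R = 2 * k%:R + (sgn R ds.2 - sgn R ds.1).
Proof.
move=> kL; rewrite /step_prob mulf_eq0 negb_or => /andP[+ _].
case: ds => -[] s /=; rewrite /jar_next/=.
  case: k kL => [|k] kL; first by rewrite mul0r eqxx.
  move=> _; rewrite subSS subn0; split; first by case: s => /=; rewrite ?addn1 ?addn0// ltnW.
  by rewrite natrD -natr1; case: s; rewrite /sgn/=; ring.
rewrite subn0; have [->|kL'] := eqVneq k L; first by rewrite subnn mul0r eqxx.
move=> _; split; first by case: s => /=; rewrite ?addn0// addn1 ltn_neqAle kL'.
by rewrite natrD; case: s; rewrite /sgn/=; ring.
Qed.

Lemma path_prob_support k h : (k <= L)%N -> path_prob L p k h != 0 ->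
  `|sign_sum h - noise_sum h| <= (1 + v) * L%:R.
Proof.
move=> kL hk.
(* The middle term is twice the final number of plus signs, hence between 0 and [2 * L], as is
   [2 * k]. *)
suff [H0 HL] : 0 <= 2 * k%:R + \sum_(ds <- h) (sgn R ds.2 - sgn R ds.1) <= 2 * L%:R /\
   sign_sum h - noise_sum h = (1 - v) / 2 * \sum_(ds <- h) (sgn R ds.2 - sgn R ds.1).
  rewrite HL normrM.
  have kLR : (k%:R : R) <= L%:R by rewrite ler_nat.
  have k0 := ler0n R k.
  have : `|\sum_(ds <- h) (sgn R ds.2 - sgn R ds.1)| <= 2 * L%:R.
    by move: H0 => /andP[? ?]; rewrite ler_norml; apply/andP; split; lra.
  have : `|(1 - v) / 2| <= (1 + v) / 2.
    by have := v_ge0; rewrite ler_norml => ?; apply/andP; split; lra.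
  move=> A B; apply: (le_trans (ler_pM _ _ A B)) => //.
  by rewrite mulrA divfK// pnatr_eq0.
split; last first.
  rewrite /sign_sum /noise_sum -sumrB mulr_sumr; apply: eq_bigr => -[d s] _.
  by rewrite /noise /sgn; case: d; case: s => /=; field.
elim: h k kL hk => [|ds h IH] k kL /=.
  by move=> _; rewrite big_nil addr0 mulr_ge0//= ler_wpM2l// ler_nat.
rewrite mulf_eq0 negb_or big_cons => /andP[s0 h0]; rewrite addrA.
by have [k'L <-] := step_prob_support kL s0; exact: IH.
Qed.

Lemma path_expectD k t F F' :
  path_expect k t (fun h => F h + F' h) = path_expect k t F + path_expect k t F'.
Proof. by rewrite /path_expect -big_split; apply: eq_bigr => h _; rewrite mulrDr. Qed.

Lemma path_expectZ k t (c : R) F : path_expect k t (fun h => c * F h) = c * path_expect k t F.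
Proof. by rewrite /path_expect mulr_sumr; apply: eq_bigr => h _; rewrite mulrCA. Qed.

Lemma path_expect_le k t F F' : (forall h, path_prob L p k h != 0 -> F h <= F' h) ->
  path_expect k t F <= path_expect k t F'.
Proof.
move=> FF'; apply: ler_sum => h _; have [->|h0] := eqVneq (path_prob L p k h) 0.
  by rewrite !mul0r.
by rewrite ler_wpM2l ?path_prob_ge0 ?FF'.
Qed.

Lemma path_expect_dist_le k t F F' (B : seq (bool * bool) -> R) :
  (forall h, path_prob L p k h != 0 -> `|F h - F' h| <= B h) ->
  `|path_expect k t F - path_expect k t F'| <= path_expect k t B.
Proof.
move=> FF'; rewrite /path_expect -sumrB; apply: (le_trans (ler_norm_sum _ _ _)).
apply: ler_sum => h _; rewrite -mulrBr normrM (ger0_norm (path_prob_ge0 _ _)).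
have [->|h0] := eqVneq (path_prob L p k h) 0; first by rewrite !mul0r.
by rewrite ler_wpM2l ?path_prob_ge0 ?FF'.
Qed.

Lemma path_expect0 k F : path_expect k 0 F = F [::].
Proof.
rewrite /path_expect (bigD1 [tuple])//= mul1r big1 ?addr0// => h.
by move=> /negP[]; apply/eqP; exact: tuple0.
Qed.

(** First-step decomposition: the rest of the path follows the law started from the updated jar. All
    inductions on [t] below use it. *)
Lemma path_expectS k t F :
  path_expect k t.+1 F =
  \sum_ds step_prob L p k ds * path_expect (jar_next k ds) t (fun h => F (ds :: h)).
Proof.
rewrite /path_expect; under [RHS]eq_bigr do rewrite mulr_sumr.
rewrite pair_bigA/= (reindex (fun x : (bool * bool) * t.-tuple (bool * bool) => [tuple of x.1 :: x.2]))/=.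
  by apply: eq_bigr => -[ds h] _ /=; rewrite mulrA.
apply: onW_bij; exists (fun h : t.+1.-tuple (bool * bool) => (thead h, [tuple of behead h])).
  by move=> [ds h]; congr (_, _); apply: val_inj.
by move=> h; rewrite [RHS]tuple_eta; apply: val_inj.
Qed.

Lemma path_expect_cst k t (c : R) : (k <= L)%N -> path_expect k t (fun=> c) = c.
Proof.
elim: t k => [|t IH] k kL; first by rewrite path_expect0.
rewrite path_expectS -[RHS]mul1r -(step_prob_sum1 kL) mulr_suml; apply: eq_bigr => ds _.
(* The induction hypothesis needs a jar with at most [L] plus signs, which is known on steps of
   positive probability; the others contribute 0. *)
have [->|s0] := eqVneq (step_prob L p k ds) 0; first by rewrite !mul0r.
by rewrite IH//; case: (step_prob_support kL s0).
Qed.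

(** The free start [x] absorbs the first increment; its cross term has mean 0, so each step adds
    exactly [v]. *)
Lemma noise_sum_sqr k t (x : R) : (k <= L)%N ->
  path_expect k t (fun h => (x + noise_sum h) ^+ 2) = x ^+ 2 + v * t%:R.
Proof.
elim: t k x => [|t IH] k x kL.
  by rewrite path_expect0 /noise_sum big_nil mulr0 !addr0.
have E := step_noise (x ^+ 2 + v * t%:R) (2 * x) 1 kL.
rewrite path_expectS -natr1 mulrDr addrA -E; apply: eq_bigr => ds _.
have [->|s0] := eqVneq (step_prob L p k ds) 0; first by rewrite !mul0r.
rewrite /noise_sum; under eq_fun do rewrite big_cons addrA.
have [k'L _] := step_prob_support kL s0.
by rewrite (IH _ (x + noise ds) k'L); congr (_ * _); ring.
Qed.

End walk.

(** * Lindeberg's argument *)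

Section lindeberg.
Variables (R : realType) (L : nat) (p : R).
Hypotheses (L0 : (0 < L)%N) (p0 : 0 <= p) (p1 : p < 1).
Let v := p / (1 - p).
Let v_ge0 : 0 <= v. Proof. by rewrite divr_ge0// subr_ge0 ltW. Qed.
Notation G := (gauss_expect v).

Lemma step_average_le k (F F' : bool * bool -> R) (B : R) : (k <= L)%N ->
  (forall ds, step_prob L p k ds != 0 -> `|F ds - F' ds| <= B) ->
  `|\sum_ds step_prob L p k ds * F ds - \sum_ds step_prob L p k ds * F' ds| <= B.
Proof.
move=> kL FF; rewrite -sumrB; apply: (le_trans (ler_norm_sum _ _ _)).
rewrite [leRHS](_ : _ = \sum_ds step_prob L p k ds * B); last first.
  by rewrite -mulr_suml step_prob_sum1// mul1r.
apply: ler_sum => ds _; rewrite -mulrBr normrM (ger0_norm (step_prob_ge0 _ _ _ _ _))//.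
have [->|s0] := eqVneq (step_prob L p k ds) 0; first by rewrite !mul0r.
by rewrite ler_wpM2l ?step_prob_ge0// FF.
Qed.

Section smooth.
Variables (f f1 f2 : R -> R) (C : R).
Hypothesis df : forall x : R, is_derive x 1 f (f1 x).
Hypothesis df1 : forall x : R, is_derive x 1 f1 (f2 x).
Hypothesis cf2 : continuous f2.
Hypothesis fC : forall x, `|f x| <= C.
Hypothesis f1C : forall x, `|f1 x| <= C.
Hypothesis f2C : forall x, `|f2 x| <= C.
Hypothesis taylor3 : forall x h, `|f (x + h) - f x - h * f1 x - h ^+ 2 / 2 * f2 x| <= C * `|h| ^+ 3.

Let C0 : 0 <= C. Proof. exact: le_trans (fC 0). Qed.

Let U := gauss_smooth v f.
(** The first summand comes from the cubic space error with noise at most [1 + v], the second from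
    the error of the scale expansion. *)
Let K := C * (1 + v) ^+ 3 + C * (v / 2 + G (fun z => z ^+ 2)).

Let m2_ge0 : 0 <= G (fun z => z ^+ 2).
Proof.
rewrite -(gauss_expect_cst 0 v_ge0); apply: gauss_expect_le => //.
- exact: growth2_cst.
- exact: growth2_sqr.
- by move=> x; exact: sqr_ge0.
Qed.

Lemma noise_bound ds : `|noise p ds| <= 1 + v.
Proof.
rewrite /noise normrM -/v.
have -> : `|sgn R ds.2| = 1 by rewrite /sgn; case: ifP; rewrite ?normrN normr1.
by rewrite mul1r; case: ifP => _; rewrite ?normr1 ?(ger0_norm v_ge0) ?lerDl ?lerDr.
Qed.

(** One noise increment of size [d] is merged into the Gaussian, whose scale grows from [a] to [b].
    Both quantities are close to the same second-order expansion [A + v * (d ^+ 2 / 2 * A2)]. *)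
Lemma lindeberg_step k (a b d x : R) : (k <= L)%N -> 0 <= d -> b ^+ 2 = a ^+ 2 + d ^+ 2 ->
  `|\sum_ds step_prob L p k ds * U a (x + d * noise p ds) - U b x| <= K * (d ^+ 3 + (b - a) ^+ 2).
Proof.
move=> kL d0 ab.
pose A := U a x; pose A1 := gauss_smooth v f1 a x; pose A2 := gauss_smooth v f2 a x.
have A2C : `|A2| <= C by exact: gauss_smooth_bound.
have E := step_noise L0 p1 A (d * A1) (d ^+ 2 / 2 * A2) kL; rewrite -/v in E.
have S1 : `|\sum_ds step_prob L p k ds * U a (x + d * noise p ds) - (A + v * (d ^+ 2 / 2 * A2))| <= C * (1 + v) ^+ 3 * d ^+ 3.
  rewrite -E; apply: step_average_le => // ds _.
  have := gauss_smooth_space v_ge0 df df1 cf2 fC f1C f2C taylor3 a x (d * noise p ds).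
  rewrite -/U -/A -/A1 -/A2.
  rewrite (_ : A + _ + _ = A + noise p ds * (d * A1) + noise p ds ^+ 2 * (d ^+ 2 / 2 * A2)); last by ring.
  move/le_trans; apply; rewrite -mulrA ler_wpM2l// -exprMn lerXn2r ?nnegrE//.
    by rewrite mulr_ge0// addr_ge0.
  by rewrite normrM (ger0_norm d0) mulrC ler_wpM2r// noise_bound.
have S2 := gauss_smooth_time v_ge0 df df1 cf2 fC f1C f2C a b x.
rewrite -/U -/A -/A2 in S2.
(* This is $(b-a)a = (b^2-a^2)/2 - (b-a)^2/2$ with $b^2-a^2 = d^2$. *)
have E2 : (b - a) * (v * (a * A2)) = v * (d ^+ 2 / 2 * A2) - v * A2 / 2 * (b - a) ^+ 2.
  have -> : d ^+ 2 = b ^+ 2 - a ^+ 2 by rewrite ab addrC addKr.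
  by field.
rewrite E2 in S2.
have S3 : `|v * A2 / 2 * (b - a) ^+ 2| <= C * (v / 2) * (b - a) ^+ 2.
  have v20 : 0 <= v / 2 by rewrite divr_ge0.
  rewrite normrM (ger0_norm (sqr_ge0 _)) ler_wpM2r ?sqr_ge0//.
  rewrite mulrAC normrM (ger0_norm v20) mulrC ler_wpM2r//.
(* The two cross products are nonnegative, so the separate errors fit under the single product with
   [K]. *)
have : 0 <= C * (1 + v) ^+ 3 * (b - a) ^+ 2.
  by rewrite mulr_ge0 ?sqr_ge0// mulr_ge0// exprn_ge0// addr_ge0.
have : 0 <= C * (v / 2 + G (fun z => z ^+ 2)) * d ^+ 3.
  by rewrite mulr_ge0 ?exprn_ge0// mulr_ge0// addr_ge0// divr_ge0.
rewrite /K; move: S1 S2 S3; rewrite !ler_norml => /andP[? ?] /andP[? ?] /andP[? ?] ? ?.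
by apply/andP; split; lra.
Qed.

(** By induction the tail is exchanged for a Gaussian, uniformly in the jar and the starting point;
    [lindeberg_step] then merges the first increment. The errors $(b-a)^2 \le d(b-a)$ telescope to
    $d \cdot d\sqrt t$. *)
Lemma lindeberg_sum k t (d x : R) : (k <= L)%N -> 0 <= d ->
  `|path_expect L p k t (fun h => f (x + d * noise_sum p h)) - U (d * Num.sqrt t%:R) x|
  <= K * (t%:R * d ^+ 3 + d * (d * Num.sqrt t%:R)).
Proof.
move=> kL d0; elim: t k x kL => [|t IH] k x kL.
  rewrite path_expect0 /noise_sum big_nil sqrtr0 !mulr0 addr0 /U gauss_smooth0//.
  by rewrite subrr normr0 mul0r addr0 mulr0.
set a := d * Num.sqrt t%:R in IH *; set b := d * Num.sqrt t.+1%:R.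
have ab : b ^+ 2 = a ^+ 2 + d ^+ 2.
  by rewrite /a /b !exprMn !sqr_sqrtr// -natr1 mulrDr mulr1.
have a0 : 0 <= a by rewrite mulr_ge0.
have b0 : 0 <= b by rewrite mulr_ge0.
have leab : a <= b by rewrite ler_wpM2l// ler_sqrt// ler_nat.
have bad : b - a <= d.
  (* Otherwise $b^2 - (a+d)^2$ would be positive, while it equals $-2ad$. *)
  rewrite leNgt; apply/negP => dba.
  have : 0 < (b - a - d) * (b + a + d).
    by apply: mulr_gt0; lra.
  have := mulr_ge0 a0 d0; rewrite (_ : _ * (b + a + d) = b ^+ 2 - a ^+ 2 - d ^+ 2 - 2 * (a * d)); last by ring.
  by rewrite ab; lra.
have S := lindeberg_step x kL d0 ab.
have H : `|path_expect L p k t.+1 (fun h => f (x + d * noise_sum p h)) -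
   \sum_ds step_prob L p k ds * U a (x + d * noise p ds)| <= K * (t%:R * d ^+ 3 + d * a).
  rewrite path_expectS; apply: step_average_le => // ds s0.
  have [k'L _] := step_prob_support kL s0.
  rewrite /noise_sum; under eq_fun do rewrite big_cons mulrDr addrA.
  exact: IH.
rewrite (le_trans (ler_distD (\sum_ds step_prob L p k ds * U a (x + d * noise p ds)) _ _))//.
apply: (le_trans (lerD H S)); rewrite -mulrDr ler_wpM2l//.
  by rewrite /K addr_ge0// mulr_ge0 ?exprn_ge0 ?addr_ge0// divr_ge0.
have : (b - a) ^+ 2 <= d * (b - a) by rewrite expr2 ler_wpM2r// subr_ge0.
by rewrite -natr1; lra.
Qed.

End smooth.

(** With $d = 1/\sqrt t$ the final Gaussian scale is 1 and the Lindeberg error is $2K/\sqrt t$ for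
    the constant of that argument. Passing from walk to martingale moves the argument of [f] by
    $O(1/\sqrt t)$, which the bound on [f1] controls. *)
Lemma smooth_clt (x0 : R) f : smoothb 3 f -> exists K, forall k t, (k <= L)%N -> (0 < t)%N ->
  `|path_expect L p k t (fun h => f ((x0 + sign_sum R h) / Num.sqrt t%:R)) - G f| <= K / Num.sqrt t%:R.
Proof.
move=> [_ [[C0 fC0] [f1 [df [_ [[C1 fC1] [f2 [df1 [cf2 [[C2 fC2] [f3 [df2 [_ [[C3 fC3] _]]]]]]]]]]]]]].
pose C := `|C0| + `|C1| + `|C2| + `|C3|.
have le_C : [/\ C0 <= C, C1 <= C, C2 <= C & C3 <= C].
  have := ler_norm C0; have := ler_norm C1; have := ler_norm C2; have := ler_norm C3.
  have := normr_ge0 C0; have := normr_ge0 C1; have := normr_ge0 C2; have := normr_ge0 C3.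
  by rewrite /C => *; split; lra.
have fC x : `|f x| <= C by apply: (le_trans (fC0 x)); case: le_C.
have f1C x : `|f1 x| <= C by apply: (le_trans (fC1 x)); case: le_C.
have f2C x : `|f2 x| <= C by apply: (le_trans (fC2 x)); case: le_C.
have f3C x : `|f3 x| <= C by apply: (le_trans (fC3 x)); case: le_C.
have C_ge0 : 0 <= C by exact: le_trans (fC 0).
have T3 x h := taylor2 x h df df1 df2 f3C.
exists (C * (`|x0| + (1 + v) * L%:R) + (C * (1 + v) ^+ 3 + C * (v / 2 + G (fun z => z ^+ 2))) * 2) => k t kL t0.
have st0 : 0 < Num.sqrt t%:R :> R by rewrite sqrtr_gt0 ltr0n.
have d0 : 0 <= (Num.sqrt t%:R)^-1 :> R by rewrite invr_ge0 ltW.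
have B := lindeberg_sum df df1 cf2 fC f1C f2C T3 t 0 kL d0.
have dt : t%:R * (Num.sqrt t%:R)^-1 ^+ 3 = (Num.sqrt t%:R)^-1 :> R.
  by rewrite -{1}(sqr_sqrtr (ler0n R t)); field; rewrite gt_eqF.
rewrite dt mulVf ?gt_eqF// mulr1 in B.
have GU : G f = gauss_smooth v f 1 0.
  by rewrite /gauss_smooth; congr G; apply/funext => z; rewrite add0r mul1r.
have A : `|path_expect L p k t (fun h => f ((x0 + sign_sum R h) / Num.sqrt t%:R))
   - path_expect L p k t (fun h => f (0 + (Num.sqrt t%:R)^-1 * noise_sum p h))|
   <= C * (`|x0| + (1 + v) * L%:R) / Num.sqrt t%:R.
  rewrite -[leRHS](path_expect_cst L0 p1 t _ kL); apply: path_expect_dist_le => // h hh.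
  rewrite add0r.
  set z := (x0 + sign_sum R h) / _; set y := _ * noise_sum p h.
  have -> : z = y + (z - y) by rewrite addrC subrK.
  apply: (le_trans (mvt_bound df (fun x _ => f1C x))).
  rewrite -mulrA ler_wpM2l// /z /y (mulrC _ (noise_sum _ _)) -mulrBl normrM (ger0_norm d0) ler_wpM2r//.
  rewrite -addrA (le_trans (ler_normD _ _))// lerD2l.
  exact: path_prob_support hh.
rewrite (le_trans (ler_distD (path_expect L p k t (fun h => f (0 + (Num.sqrt t%:R)^-1 * noise_sum p h))) _ _))//.
rewrite mulrDl lerD//; move: B; rewrite -GU; move/le_trans; apply; rewrite le_eqVlt; apply/orP; left; apply/eqP; ring.
Qed.

(** The walk is the noise sum plus an error [e] bounded by [c], and $(n+e)^2 \le 2n^2+2e^2$. The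
    factor [t.+1] covers [t = 0]. *)
Lemma sign_sum_sqr (x0 : R) : exists2 K, 0 <= K & forall k t, (k <= L)%N ->
  path_expect L p k t (fun h => (x0 + sign_sum R h) ^+ 2) <= K * t.+1%:R.
Proof.
pose c := `|x0| + (1 + v) * L%:R.
have c0 : 0 <= c by rewrite addr_ge0// mulr_ge0// addr_ge0.
exists (2 * v + 2 * c ^+ 2) => [|k t kL].
  by rewrite addr_ge0// mulr_ge0// exprn_ge0.
have N := noise_sum_sqr L0 p1 t 0 kL.
apply: (@le_trans _ _ (path_expect L p k t (fun h => 2 * (0 + noise_sum p h) ^+ 2 + 2 * c ^+ 2))).
  apply: path_expect_le => // h hh.
  have := path_prob_support p0 p1 kL hh; rewrite -/v => sn.
  have : `|x0 + sign_sum R h - noise_sum p h| <= c.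
    by rewrite -addrA (le_trans (ler_normD _ _))// lerD2l.
  set e := x0 + _ - _ => ec.
  have -> : x0 + sign_sum R h = noise_sum p h + e by rewrite /e; ring.
  have : e ^+ 2 <= c ^+ 2 by rewrite -(real_normK (num_real e)) lerXn2r ?nnegrE.
  by rewrite add0r; have := sqr_ge0 (noise_sum p h - e); nra.
rewrite path_expectD path_expectZ N path_expect_cst// expr0n add0r -/v -natr1.
have := mulr_ge0 v_ge0 (ler0n R t); have : 0 <= c ^+ 2 * t%:R by rewrite mulr_ge0// exprn_ge0.
have := v_ge0; lra.
Qed.

Lemma walk_clt (x0 : R) f k : (k <= L)%N -> continuous f -> bounded_fct f ->
  (fun t : nat => path_expect L p k t (fun h => f ((x0 + sign_sum R h) / Num.sqrt t%:R))) @ \oo --> G f.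
Proof.
move=> kL cf bf; have [K K0 sqrK] := sign_sum_sqr x0.
pose Q := G (fun z => 1 + z ^+ 2).
have g2 : growth2 (fun z : R => 1 + z ^+ 2) by apply: growth2D; [exact: growth2_cst|exact: growth2_sqr].
have Q0 : 0 <= Q.
  rewrite -(gauss_expect_cst 0 v_ge0); apply: gauss_expect_le => //.
  - exact: growth2_cst.
  - by move=> x; rewrite addr_ge0// sqr_ge0.
apply/cvgrPdist_le => e e0.
have D0 : 0 < 2 * (1 + 2 * K + Q) by rewrite mulr_gt0// -addrA ltr_pwDl// addr_ge0// mulr_ge0.
(* Error budget: [e' * Q] for the Gaussian side, [e' * (1 + 2 * K)] for the walk side, [e / 2] for
   the smooth limit theorem. The [2 * K] comes from $(t+1)/t \le 2$. *)
have [e' e'0 eE] : exists2 e', 0 < e' & e = e' * (2 * (1 + 2 * K + Q)).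
  by exists (e / (2 * (1 + 2 * K + Q))); rewrite ?divr_gt0// divfK// gt_eqF.
have [g sg fg] := smoothb3_dense cf bf e'0.
have [C smC] := smooth_clt x0 sg.
have cg := smoothb_cont sg; have bg := smoothb_bounded sg.
have Gfg : `|G f - G g| <= e' * Q.
  rewrite -mulN1r -gauss_expectZ//; last exact: growth2_bounded.
  rewrite -gauss_expectD//; [|exact: growth2_bounded|exact/growth2Z/growth2_bounded].
  rewrite -gauss_expectZ//; apply: gauss_expect_norm_le => //.
  - by apply: growth2D; [exact: growth2_bounded|exact/growth2Z/growth2_bounded].
  - exact: growth2Z.
  - by move=> x; rewrite mulN1r.
have e2 : 0 < e / 2 by rewrite divr_gt0.
(* Once [M ^+ 2 <= t], the error $C/\sqrt t$ is at most [e / 2]. *)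
pose M := `|C| / (e / 2).
near=> t.
have t0 : (0 < t)%N by near: t; exact: nbhs_infty_gt.
have st0 : 0 < Num.sqrt t%:R :> R by rewrite sqrtr_gt0 ltr0n.
pose E F := path_expect L p k t (fun h => F ((x0 + sign_sum R h) / Num.sqrt t%:R) : R).
have Efg : `|E g - E f| <= e' * (1 + 2 * K).
  pose c := e' / t%:R.
  apply: (@le_trans _ _ (path_expect L p k t (fun h => e' + c * (x0 + sign_sum R h) ^+ 2))).
    apply: path_expect_dist_le => // h _; rewrite distrC (le_trans (fg _))//.
    by rewrite mulrDr mulr1 lerD2l exprMn exprVn sqr_sqrtr// /c (mulrC (_ ^+ 2)) mulrA.
  rewrite path_expectD path_expectZ path_expect_cst// [leRHS]mulrDr mulr1 lerD2l.
  have c0 : 0 <= c by rewrite divr_ge0// ltW.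
  apply: (le_trans (ler_wpM2l c0 (sqrK k t kL))); rewrite /c -mulrA ler_pM2l//.
  rewrite mulrC ler_pdivrMr ?ltr0n// (mulrC 2) -mulrA ler_wpM2l//.
  by rewrite -natr1 mulr_natl mulr2n lerD2l ler1n.
have Eg : `|E g - G g| <= e / 2.
  apply: (le_trans (smC k t kL t0)); rewrite ler_pdivrMr// (le_trans (ler_norm _))//.
  rewrite mulrC -ler_pdivrMr// -/M.
  have M0 : 0 <= M by rewrite divr_ge0// ltW.
  rewrite -(ger0_norm M0) -sqrtr_sqr ler_sqrt ?ler0n//.
  by near: t; exact: nbhs_infty_ger.
have -> : e = e' * Q + e / 2 + e' * (1 + 2 * K).
  by rewrite eE; field.
rewrite (le_trans (ler_distD (E g) _ _))// lerD//.
rewrite (le_trans (ler_distD (G g) _ _))// lerD//.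
by rewrite distrC.
Unshelve. all: by end_near. Qed.

End lindeberg.

(** * Limit theorems for the process *)

Section process.
Variables (R : realType) (L : nat) (p : R) (d : measure_display) (T : measurableType d).
Variables (P : probability T R) (N0p : nat) (D S : nat -> T -> bool).
Hypothesis mD : forall i b, measurable [set w | D i w = b].
Hypothesis mS : forall i b, measurable [set w | S i w = b].
Hypothesis lawP : forall h : seq (bool * bool),
  P [set w | forall i, (i < size h)%N -> (D i w, S i w) = nth (true, true) h i]
  = (path_prob L p N0p h)%:E.

Definition cylinder (h : seq (bool * bool)) : set T :=
  [set w | forall i, (i < size h)%N -> (D i w, S i w) = nth (true, true) h i].

Definition history t w : t.-tuple (bool * bool) := [tuple (D i w, S i w) | i < t].

Lemma measurable_cylinder h : measurable (cylinder h).
Proof.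
rewrite (_ : cylinder h = \bigcap_(i in `I_(size h))
   ([set w | D i w = (nth (true, true) h i).1] `&` [set w | S i w = (nth (true, true) h i).2])).
  by apply: bigcap_measurableType => i _; apply: measurableI.
apply/seteqP; split=> w /= H i ih.
  by split; rewrite -H.
by case: (H i ih) => /= -> ->; case: (nth _ _ _).
Qed.

Lemma in_cylinder t (h : t.-tuple (bool * bool)) w : (w \in cylinder h) = (h == history t w).
Proof.
apply/idP/eqP => [|->].
  rewrite inE => H; apply: eq_from_tnth => i; rewrite tnth_mktuple (tnth_nth (true, true)) -H//.
  by rewrite size_tuple.
rewrite inE => i; rewrite (size_tuple (history t w)) => it.
transitivity (tnth (history t w) (Ordinal it)); first by rewrite tnth_mktuple.
by rewrite (tnth_nth (true, true)).
Qed.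

(** The history takes finitely many values, so the integrand is a finite combination of cylinder
    indicators, whose probabilities [lawP] prescribes. *)
Lemma integral_history t (F : seq (bool * bool) -> R) :
  P.-integrable setT (fun w => (F (history t w))%:E) /\
  (\int[P]_w (F (history t w))%:E = (path_expect L p N0p t F)%:E)%E.
Proof.
have FE : (fun w => (F (history t w))%:E) =
  (fun w => \sum_(h : t.-tuple (bool * bool)) (F h)%:E * (\1_(cylinder h) w)%:E)%E.
  apply/funext => w; rewrite (bigD1 (history t w))// indicE in_cylinder eqxx mule1.
  rewrite big1 => [|h /negbTE hw]; first exact/esym/adde0.
  by rewrite indicE in_cylinder hw mule0.
have ind h : P.-integrable setT (fun w => (F h)%:E * (\1_(cylinder h) w)%:E)%E.
  by apply: integrableZl => //; apply: integrable_indic; exact: measurable_cylinder.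
rewrite FE; split; first by apply: integrable_sum.
rewrite integral_sum// -sumEFin; apply: eq_bigr => h _.
rewrite integralZl//; last first.
  by apply: integrable_indic; exact: measurable_cylinder.
rewrite integral_indic ?setIT//; last exact: measurable_cylinder.
transitivity ((F h)%:E * (path_prob L p N0p h)%:E)%E; first by congr (_ * _)%E; exact: lawP.
by rewrite -EFinM mulrC.
Qed.

Lemma sign_sum_history t w : sign_sum R (history t w) = \sum_(i < t) sgn R (S i w).
Proof. by rewrite /sign_sum big_map big_enum. Qed.


(** * Law of large numbers and weak convergence for the process *)

Hypotheses (L0 : (0 < L)%N) (p0 : 0 <= p) (p1 : p < 1) (N0L : (N0p <= L)%N).
Variable x0 : R.

Let X t w : R := x0 + \sum_(i < t) sgn R (S i w).

Let X_lipschitz s t w : (s <= t)%N -> `|X t w - X s w| <= (t - s)%:R.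
Proof.
move=> /subnK <-; rewrite addnK; elim: (t - s)%N => [|n IH]; first by rewrite add0n subrr normr0.
have -> : X (n.+1 + s)%N w - X s w = X (n + s)%N w - X s w + sgn R (S (n + s)%N w).
  by rewrite /X addSn big_ord_recr/=; ring.
rewrite -natr1 (le_trans (ler_normD _ _))// lerD//.
by rewrite /sgn; case: ifP; rewrite ?normrN normr1.
Qed.

(** Along squares the second moments are $O(1/n^2)$, so the series [Z] has finite integral. It is
    then finite almost everywhere, and its terms tend to 0. *)
Lemma ae_square_subsequence :
  {ae P, forall w, (fun n : nat => (X (n.+1 ^ 2)%N w / (n.+1 ^ 2)%:R) ^+ 2) @ \oo --> (0 : R)}.
Proof.
pose F n (h : seq (bool * bool)) : R := ((x0 + sign_sum R h) / (n.+1 ^ 2)%:R) ^+ 2.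
pose Y n w : R := F n (history (n.+1 ^ 2) w).
have YE n w : Y n w = (X (n.+1 ^ 2)%N w / (n.+1 ^ 2)%:R) ^+ 2 by rewrite /Y /F sign_sum_history.
have [K K0 sqrK] := sign_sum_sqr L0 p0 p1 x0.
have IY n : (\int[P]_w (Y n w)%:E <= (2 * K * (n.+1%:R ^- 2))%:E)%E.
  have [_ ->] := integral_history (n.+1 ^ 2) (F n); rewrite lee_fin.
  have -> : F n = fun h => ((n.+1 ^ 2)%:R ^- 2) * (x0 + sign_sum R h) ^+ 2.
    by apply/funext => h; rewrite /F exprMn exprVn mulrC.
  rewrite path_expectZ.
  have := sqrK N0p (n.+1 ^ 2)%N N0L.
  have c0 : 0 <= ((n.+1 ^ 2)%:R ^- 2 : R) by rewrite invr_ge0 sqr_ge0.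
  move/(ler_wpM2l c0)/le_trans; apply.
  have m0 : (n.+1 ^ 2)%:R != 0 :> R by rewrite pnatr_eq0.
  have m1 : 1 <= (n.+1 ^ 2)%:R :> R by rewrite ler1n expn_gt0.
  rewrite -(natrX _ n.+1 2) -[(n.+1 ^ 2).+1%:R]natr1; move: m0 m1; set m := (n.+1 ^ 2)%:R => m0 m1.
  have mp : 0 < m by exact: lt_le_trans m1.
  rewrite ler_pdivlMr// (_ : _ * m = K * (m + 1) / m); last by field.
  rewrite ler_pdivrMr// -subr_ge0 (_ : _ - _ = K * (m - 1)); last by ring.
  by rewrite mulr_ge0// subr_ge0.
have mY n : measurable_fun setT (fun w => (Y n w)%:E).
  by have [/integrableP[]] := integral_history (n.+1 ^ 2) (F n).
have Y0 n w : (0 <= (Y n w)%:E)%E by rewrite lee_fin sqr_ge0.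
pose Z w := (\sum_(n <oo) (Y n w)%:E)%E.
(* The induction gains $1/(N(N+1)^2)$ at each step. At [N = 0] the inverse of 0 is 0, so the passage
   to 1 is done by hand. *)
have sumV2 N : \sum_(0 <= n < N) (n.+1%:R ^- 2 : R) <= 2 - N%:R^-1.
  elim: N => [|N IH]; first by rewrite big_nil invr0 subr0.
  rewrite big_nat_recr//=; have [->|N0] := posnP N.
    by rewrite big_nil add0r expr1n invr1; lra.
  apply: (le_trans (lerD IH (lexx _))); rewrite -natr1.
  have x0' : 0 < N%:R :> R by rewrite ltr0n.
  have x1 : 0 < N%:R + 1 :> R by rewrite addr_gt0.
  rewrite -subr_ge0 (_ : _ - _ = (N%:R * (N%:R + 1) ^+ 2)^-1).
    by rewrite invr_ge0 mulr_ge0// ?exprn_ge0// ltW.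
  by field; rewrite !gt_eqF.
have IZ : (\int[P]_w Z w <= (2 * K * 2)%:E)%E.
  rewrite integral_nneseries//.
  apply: lime_le; first by apply: is_cvg_nneseries => n _ _; exact: integral_ge0.
  apply: nearW => N; apply: (@le_trans _ _ (\sum_(0 <= n < N) (2 * K * n.+1%:R ^- 2)%:E)%E).
    exact: lee_sum.
  rewrite sumEFin lee_fin -mulr_sumr ler_wpM2l ?mulr_ge0//.
  by rewrite (le_trans (sumV2 N))// gerBl invr_ge0.
have iZ : P.-integrable setT Z.
  apply/integrableP; split.
    by apply: ge0_emeasurable_sum.
  under eq_integral do rewrite gee0_abs ?nneseries_ge0//.
  by rewrite (le_lt_trans IZ)// ltry.
apply: filterS (integrable_ae measurableT iZ) => w /(_ I) Zw.
under eq_fun do rewrite -YE.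
apply: cvg_series_cvg_0; apply: nondecreasing_is_cvgn.
  by apply: nondecreasing_series => n _ _; exact: sqr_ge0.
exists (fine (Z w)) => _ [n _ <-].
rewrite -lee_fin fineK// /series/= -sumEFin.
by apply: nneseries_lim_ge.
Qed.

(** Between consecutive squares $n^2 \le t < (n+1)^2$ the walk moves by at most $2n$, which is
    negligible against $t$. *)
Lemma walk_slln : {ae P, forall w, (fun t : nat => X t w / t%:R) @ \oo --> (0 : R)}.
Proof.
apply: filterS ae_square_subsequence => w cv.
apply/cvgrPdist_le => e e0.
have e2 : 0 < (e / 2) ^+ 2 by rewrite exprn_gt0// divr_gt0.
have /cvgrPdist_le/(_ _ e2) [N _ HN] := cv.
have [M HM] : exists M : nat, forall m : nat, (M <= m)%N -> 2 / m%:R <= e / 2.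
  exists (Num.truncn (4 / e)).+1 => m Mm.
  have m0 : (0 < m)%N by exact: leq_trans Mm.
  have /ltW : 4 / e < m%:R by apply: (lt_le_trans (truncnS_gt _)); rewrite ler_nat.
  rewrite ler_pdivrMr// => H; rewrite ler_pdivrMr ?ltr0n//; lra.
near=> t; rewrite sub0r normrN.
have [n nt tn] : exists2 n, (n ^ 2 <= t)%N & (t < n.+1 ^ 2)%N.
  have ex : exists n, (n ^ 2 <= t)%N by exists 0%N.
  have bd n : (n ^ 2 <= t)%N -> (n <= t)%N by case: n => // n; apply: leq_trans; rewrite -mulnn leq_pmulr.
  case: (ex_maxnP ex bd) => n nt nmax; exists n => //.
  by rewrite ltnNge; apply/negP => /nmax; rewrite ltnn.
(* Large [t] forces its integer square root past both thresholds: [N] for the subsequence, [M] for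
   the gap between squares. *)
have NMn : ((N + M).+1 <= n)%N.
  have : ((N + M).+1 ^ 2 <= t)%N by near: t; exact: nbhs_infty_ge.
  by move=> /leq_ltn_trans /(_ tn); rewrite ltn_exp2r// ltnS.
have n0 : (0 < n)%N by exact: leq_trans NMn.
have n0' : 0 < n%:R :> R by rewrite ltr0n.
have t0 : (0 < t)%N by apply: leq_trans nt; rewrite expn_gt0 n0.
have Xn : `|X (n ^ 2)%N w| <= e / 2 * (n ^ 2)%:R.
  (* The subsequence is indexed by [n.+1], so the square of [n] is its term [n.-1]. *)
  have : (N <= n.-1)%N by rewrite -ltnS prednK// (leq_trans _ NMn)// ltnS leq_addr.
  move=> /HN; rewrite /= prednK// sub0r normrN normrX ler_sqr ?nnegrE//; last by rewrite divr_ge0// ltW.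
  by rewrite normrM normfV (ger0_norm (ler0n _ _)) ler_pdivrMr// ltr0n expn_gt0 n0.
have Xt := X_lipschitz w nt.
have tn2 : (t - n ^ 2)%:R <= 2 * n%:R :> R.
  rewrite -natrM ler_nat leq_subLR -ltnS (leq_trans tn)// -addn1 sqrnD exp1n muln1.
  by rewrite -addnA (addnC 1) addnA addn1 mul2n -muln2 mulnC.
have n2 : 2 * n%:R <= e / 2 * (n ^ 2)%:R.
  have := HM n (leq_trans (leqW (leq_addl _ _)) NMn).
  by rewrite ler_pdivrMr// natrX expr2 mulrA => H; rewrite ler_wpM2r// ltW.
have nt' : (n ^ 2)%:R <= t%:R :> R by rewrite ler_nat.
rewrite normrM normfV (ger0_norm (ler0n _ t)) ler_pdivrMr ?ltr0n//.
have -> : X t w = X (n ^ 2)%N w + (X t w - X (n ^ 2)%N w) by ring.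
apply: (le_trans (ler_normD _ _)).
have : e * (n ^ 2)%:R <= e * t%:R by rewrite ler_wpM2l// ltW.
lra.
Unshelve. all: by end_near. Qed.

(** The integrand depends on [w] only through the history, so the integral is a finite path sum and
    [walk_clt] applies. *)
Lemma walk_weak_convergence f : continuous f -> bounded_fct f ->
  (fun t : nat => \int[P]_w f (X t w / Num.sqrt t%:R)) @ \oo --> gauss_expect (p / (1 - p)) f.
Proof.
move=> cf bf.
suff -> : (fun t : nat => \int[P]_w f (X t w / Num.sqrt t%:R)) =
  fun t => path_expect L p N0p t (fun h => f ((x0 + sign_sum R h) / Num.sqrt t%:R)).
  exact: walk_clt.
apply/funext => t.
have [_ E] := integral_history t (fun h => f ((x0 + sign_sum R h) / Num.sqrt t%:R)).
rewrite -[RHS]/(fine (_%:E)) -E /Rintegral; congr fine; apply: eq_integral => w _.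
by rewrite sign_sum_history.
Qed.

End process.

Unset Implicit Arguments.

Theorem mainTheorem13 (R : realType) (L : nat) (p : R)
  (d : measure_display) (T : measurableType d) (P : probability T R)
  (N0p : nat) (X0 : int) (D S : nat -> T -> bool) :
  (0 < L)%N -> 0 <= p -> p < 1 -> (N0p <= L)%N ->
  (forall i b, measurable [set w | D i w = b]) ->
  (forall i b, measurable [set w | S i w = b]) ->
  (forall h : seq (bool * bool),
      P [set w | forall i, (i < size h)%N -> (D i w, S i w) = nth (true, true) h i]
      = (path_prob L p N0p h)%:E) ->
  {ae P, forall w, (fun t : nat => erw_pos (R:=R) X0 S t w / t%:R) @ \oo --> (0 : R)}
  /\
  (forall f : R -> R, continuous f -> (exists M : R, forall x, `|f x| <= M) ->
     (fun t : nat => Rintegral P setT (fun w => f (erw_pos (R:=R) X0 S t w / Num.sqrt t%:R)))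
       @ \oo --> gauss_expect (p / (1 - p)) f).
Proof.
move=> L0 p0 p1 N0L mD mS lawP; split.
  exact: (walk_slln mD mS lawP L0 p0 p1 N0L X0%:~R).
move=> f cf bf.
exact: (walk_weak_convergence mD mS lawP L0 p0 p1 N0L X0%:~R cf bf).
Qed.
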